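(* Let $k \geq 1$ be an integer and let \[ f(k) = \begin{cases} \lceil k/2 \rceil^{-2} & \text{if } k \leq 6,\\ \dfrac{1}{2k-1} & \text{if } k \geq 7.\end{cases}\] Let $x \geq 0$, $a_i \geq 0$ for $i \in [k]$, and $b_{ij} = b_{ji} \geq 0$ for $1 \leq i < j \leq k$ be real numbers with \[\sum_{1 \leq i < j \leq k} b_{ij} + \sum_{i=1}^k a_i + x = 1.\] For $i \in [k]$ define \[ d_i = a_i^2 + \sum_{j \in [k]\setminus\{i\}} b_{ij}^2 + 2\sum_{j \in [k]\setminus\{i\}} a_i b_{ij} + 2 a_i x.\] Then $\min_{i \in [k]} d_i \leq f(k)$.
   Context: In the paper these numbers are the vertex weights of a ''clustered graph for $k$ colors'': an edge-colored weighted graph with vertices of weights $b_{ij}$ ($1\le i<j\le k$), $a_i$ ($i\in[k]$) and $x$, where the vertex of weight $a_i$ is joined in color $i$ to itself, to the vertex of weight $x$, and to each vertex of weight $b_{ij}$ ($j\neq i$); each vertex of weight $b_{ij}$ is joined to itself in colors $i$ and $j$; there are no other edges. The quantity $d_i$ is the density of edges of color $i$ in this weighted graph. *)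

(* Defs.v *)
From mathcomp Require Import all_boot all_order all_algebra.
From mathcomp Require Import reals.

Set Implicit Arguments.
Unset Strict Implicit.
Unset Printing Implicit Defensive.

Import Order.TTheory GRing.Theory Num.Theory.
Local Open Scope ring_scope.

(* [uphalf k] is the ceiling of k/2. *)
Definition density_bound (R : realType) (k : nat) : R :=
  if (k <= 6)%N then (uphalf k)%:R ^- 2 else (2 * k%:R - 1)^-1.

(* Density of color i in the clustered graph with vertex weights b_ij, a_i, x.
   The diagonal values [b i i] correspond to no vertex and are never used. *)
Definition color_density (R : realType) (k : nat) (b : 'I_k -> 'I_k -> R)
    (a : 'I_k -> R) (x : R) (i : 'I_k) : R :=
  a i ^+ 2 + \sum_(j < k | j != i) b i j ^+ 2
  + 2 * (\sum_(j < k | j != i) a i * b i j) + 2 * a i * x.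

(* The iterated minimum is seeded with the value at index 0 (which exists
   since 0 < k), so it is the minimum of the k values and nothing else. *)
Definition min_ord (R : realType) (k : nat) (hk : (0 < k)%N)
    (d : 'I_k -> R) : R :=
  \big[Num.min/d (Ordinal hk)]_(i < k) d i.

(* Main.v *)
(* Scale so that all densities are at least 1, with total weight W; then W is at
   least ceil(k/2) or sqrt(2 k - 1), the smaller of which is f(k)^(-1/2).  Put
   B_i = sum_j b_ij.  Then 2 W = sum_i (2 a_i + B_i) + 2 x and
   (a_i + B_i)^2 + 2 a_i x >= 1.
   If x >= 3/4, then a_i + B_i / 2 >= r = sqrt (1 + x^2) - x, and
   (k r + x)^2 - (2 k - 1) = ((k - 1) r - x)^2 gives W^2 >= 2 k - 1.
   If x <= 3/4, then 2 a_i + B_i >= 1, so W >= k / 2 + x; it remains to gain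
   1/2 when k is odd and x <= 1/2, where one reduces to x = 0.
   For x = 0, consider the graph of the positive b_ij.  With more edges than
   colors, some edge can be removed along a line on which the densities do not
   decrease; a leaf and its neighbour cost at least 1 and can be removed.
   Otherwise the graph is 2-regular, and its shortest edge can be
   traded for loops unless three colors near it already gain 1/2 in total. *)
Require Import Defs.
From mathcomp Require Import all_boot all_order all_algebra.
From mathcomp Require Import reals.
From mathcomp Require Import ring lra zify.

Set Implicit Arguments.
Unset Strict Implicit.
Unset Printing Implicit Defensive.

Import Order.TTheory GRing.Theory Num.Theory.
Local Open Scope ring_scope.

(** * Real inequalities for the cost of one, two and three colors *)

Section Inequalities.
Variable R : rcfType.
Implicit Types a B Q x r t u v w p q : R.

Lemma ler_of_sqr p q : 0 <= q -> p ^+ 2 <= q ^+ 2 -> p <= q.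
Proof. move=> q0 h; nra. Qed.

(** Here [a], [B], [Q] stand for a_i, sum_j b_ij and sum_j b_ij^2. If 2 a + B < 1, then (a + B)^2 +
    2 a x < (1 - a)^2 + 3 a / 2 = 1 - a (1/2 - a) <= 1. *)
Lemma color_cost_ge1 a B Q x : 0 <= a -> 0 <= B -> Q <= B ^+ 2 -> x <= 3 / 4 ->
  1 <= a ^+ 2 + 2 * a * (B + x) + Q -> 1 <= 2 * a + B.
Proof.
move=> a0 B0 QB x34 h; rewrite leNgt; apply/negP => lt1.
have h1 : 0 <= a * (3 / 4 - x) by apply: mulr_ge0; lra.
have h2 : 1 <= (a + B) ^+ 2 + 2 * a * (3 / 4) by nra.
have h3 : (a + B) ^+ 2 <= (1 - a) ^+ 2 by nra.
nra.
Qed.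

(** A loop of weight [r] alone has density 1. The bound (2 r - a)^2 + 2 a x - 1, obtained from B < 2
    r - 2 a, is convex in a and nonpositive at a = 0 (as r <= 1/2) and at a = r. *)
Lemma color_cost_large_x a B Q x r : 0 <= a -> 0 <= B -> Q <= B ^+ 2 ->
  0 <= x -> 0 <= r <= 1 / 2 -> r ^+ 2 + 2 * r * x = 1 ->
  1 <= a ^+ 2 + 2 * a * (B + x) + Q -> 2 * r <= 2 * a + B.
Proof.
move=> a0 B0 QB x0 /andP[r0 r12] hr h; rewrite leNgt; apply/negP => lt1.
have h1 : 1 <= (a + B) ^+ 2 + 2 * a * x by nra.
have ar : a < r by lra.
have h2 : (a + B) ^+ 2 < (2 * r - a) ^+ 2 by nra.
have h3 : r * ((2 * r - a) ^+ 2 + 2 * a * x - 1) <= 0.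
  have -> : r * ((2 * r - a) ^+ 2 + 2 * a * x - 1) =
    (r - a) * (4 * r ^+ 2 - 1) + a * (r ^+ 2 + 2 * r * x - 1) - r * a * (r - a) by ring.
  have : 0 <= r * a * (r - a) by apply: mulr_ge0; [apply: mulr_ge0 | lra].
  have : (r - a) * (4 * r ^+ 2 - 1) <= 0 by apply: mulr_ge0_le0; [lra | nra].
  by rewrite hr subrr mulr0; lra.
have : (2 * r - a) ^+ 2 + 2 * a * x - 1 <= 0 by rewrite -(pmulr_rle0 _ (_ : 0 < r)) //; lra.
lra.
Qed.

(* [a'] repairs the color after [x] is discarded; summed over the colors,
   either the increments cost at most [x], or the second bound already pays. *)
Lemma raise_loop a B Q x : 0 <= a -> 0 <= B -> Q <= B ^+ 2 -> 0 <= x -> x <= 1 / 2 ->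
  1 <= a ^+ 2 + 2 * a * (B + x) + Q ->
  exists2 a', a <= a' & 1 <= a' ^+ 2 + 2 * a' * B + Q /\
    (1 - 2 * x) * (a' - a) <= x * (2 * a + B - 1).
Proof.
move=> a0 B0 QB x0 x12 h.
have c1 : 1 <= 2 * a + B by apply: (color_cost_ge1 a0 B0 QB _ h); lra.
have [h0|h0] := leP 1 (a ^+ 2 + 2 * a * B + Q).
  exists a => //; split => //; nra.
(* [z - B] is the loop weight at which the density without x is exactly 1. *)
set z := Num.sqrt (1 - Q + B ^+ 2).
have z2 : z ^+ 2 = 1 - Q + B ^+ 2 by rewrite sqr_sqrtr //; lra.
have z0 : 0 <= z by apply: sqrtr_ge0.
have z1 : 1 <= z by apply: ler_of_sqr => //; lra.
have za : a + B <= z by apply: ler_of_sqr => //; nra.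
exists (z - B); first lra.
split; first by nra.
set a' := z - B; have a'a : a <= a' by rewrite /a'; lra.
have h1 : (a' - a) * (a' + a + 2 * B) <= 2 * a * x by rewrite /a'; nra.
have a'B : 1 <= a' + B by rewrite /a'; lra.
suff : a' - a <= x * (2 * a' + B - 1) by lra.
clearbody a'.
have h2 : 2 * a <= a' * (a' + a + 2 * B) by nra.
have [s0|s0] := eqVneq (a' + a + 2 * B) 0; first nra.
have sp : 0 < a' + a + 2 * B by nra.
rewrite -(ler_pM2r sp).
have : x * (2 * a) <= x * (a' * (a' + a + 2 * B)) by apply: ler_wpM2l.
have : 0 <= x * ((a' + B - 1) * (a' + a + 2 * B)).
  by apply: mulr_ge0 => //; apply: mulr_ge0; lra.
lra.
Qed.

(** Otherwise 1 + 2 v w < ((1 + 5 v / 3 + w) / 2)^2 for some w in [0, 1 - v / 3]. The difference of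
    the two sides is convex in w, and the reverse inequality holds at both endpoints because v <=
    3/5. *)
Lemma two_edge_color_cost a v w : 0 <= a -> 0 <= v <= 3 / 5 -> 0 <= w ->
  1 + 2 * v * w <= (a + v + w) ^+ 2 -> 1 + 2 / 3 * v <= 2 * a + v + w.
Proof.
move=> a0 /andP[v0 v35] w0 h; rewrite leNgt; apply/negP => lt1.
have h1 : (a + v + w) ^+ 2 < ((1 + 5 / 3 * v + w) / 2) ^+ 2 by nra.
have h2 : 0 <= w <= 1 - v / 3 by lra.
nra.
Qed.

(** [p] and [q] are the values of a + B at the two ends of an edge t whose adjacent edges are v and
    u; p + q < 2 + t says that trading t for loops does not pay. *)
Lemma two_color_cost t u v p q : 0 <= t -> t <= v -> v <= u -> u < 1 ->
  0 <= p -> 0 <= q -> 1 + 2 * t * v <= p ^+ 2 -> 1 + 2 * t * u <= q ^+ 2 ->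
  p + q < 2 + t -> v < 4 / 7 /\ 3 + 2 * t + u + v / 3 <= 2 * (p + q).
Proof.
move=> t0 tv vu u1 p0 q0 hp hq pq.
(* From v >= 4/7 and v >= t follows 2 v >= 1 + t / 4, hence 1 + 2 t v >= (1 + t / 2)^2. *)
have v47 : v < 4 / 7.
  rewrite ltNge; apply/negP => v47.
  have : 1 + t / 2 <= p by apply: ler_of_sqr => //; nra.
  have : 1 + t / 2 <= q by apply: ler_of_sqr => //; nra.
  lra.
have p1 : 1 + 5 / 6 * v * t <= p.
  apply: ler_of_sqr => //; apply: le_trans hp.
  have : v * t <= 16 / 49 by nra.
  have : 0 <= v * t by nra.
  nra.
(* Otherwise p >= 1 + c t and q >= 1 + (1 - c) t with c = 5 v / 6, against p + q < 2 + t. *)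
have uv : u + v / 3 < 1.
  rewrite ltNge; apply/negP => uv.
  have : 1 + (1 - 5 / 6 * v) * t <= q.
    apply: ler_of_sqr => //; apply: le_trans hq.
    have h1 : (1 - 5 / 6 * v) ^+ 2 * t <= v by nra.
    have : 0 <= t * (u + v / 3 - 1) by nra.
    have : 0 <= t * (v - (1 - 5 / 6 * v) ^+ 2 * t) by nra.
    nra.
  lra.
split => //.
have q1 : 1 + u * (1 - v / 2) * t <= q.
  apply: ler_of_sqr => //; apply: le_trans hq.
  have h1 : (1 - v / 2) ^+ 2 * t <= v by nra.
  have h2 : u * ((1 - v / 2) ^+ 2 * t) <= v by nra.
  have : 0 <= (t * u) * (v - u * ((1 - v / 2) ^+ 2 * t)).
    by apply: mulr_ge0; nra.
  nra.
suff : 0 <= 1 - u - v / 3 + t * (5 / 3 * v + 2 * u * (1 - v / 2) - 2) by lra.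
have hl : 0 <= 1 - v / 3 + t * (5 / 3 * v - 2) by nra.
(* The last factor is affine in u: it is [hl] at u = 0 and t v^2 / 3 at u = 1 - v / 3. *)
have : 0 <= (1 - v / 3) * (1 - u - v / 3 + t * (5 / 3 * v + 2 * u * (1 - v / 2) - 2)).
  have -> : (1 - v / 3) * (1 - u - v / 3 + t * (5 / 3 * v + 2 * u * (1 - v / 2) - 2))
    = (1 - v / 3 - u) * (1 - v / 3 + t * (5 / 3 * v - 2)) + u * (t * (v ^+ 2 / 3)) by field.
  apply: addr_ge0; apply: mulr_ge0 => //; [lra|nra|nra].
by rewrite pmulr_rge0 //; lra.
Qed.

(* [t], [u] and [t], [v] are the edges at the two ends of the shortest edge [t],
   and [v], [w] those at the far end of [v].  The last hypothesis says that
   trading [t] for loops of weight [1 - u] and [1 - v] does not pay. *)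
Lemma cycle_gain t u v w ap aq am :
  0 <= t -> t <= v -> v <= u -> 0 <= w -> 0 <= ap -> 0 <= aq -> 0 <= am ->
  1 + 2 * t * u <= (ap + t + u) ^+ 2 -> 1 + 2 * t * v <= (aq + t + v) ^+ 2 ->
  1 + 2 * v * w <= (am + v + w) ^+ 2 ->
  t + ap + aq < Num.max 0 (1 - u) + Num.max 0 (1 - v) ->
  4 <= (2 * ap + (t + u)) + (2 * aq + (t + v)) + (2 * am + (v + w)).
Proof.
move=> t0 tv vu w0 ap0 aq0 am0 h1 hn hm.
have sq1 : 1 <= aq + t + v by apply: ler_of_sqr; nra.
case: (lerP (1 - u) 0) => u1; case: (lerP (1 - v) 0) => v1; try lra.
move=> hlt.
have [v47 hh] : v < 4 / 7 /\ 3 + 2 * t + u + v / 3 <= 2 * ((aq + t + v) + (ap + t + u)).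
  by apply: two_color_cost => //; lra.
(* The two ends of t cost at least 3 - 2 v / 3 and the third color at least 1 + 2 v / 3. *)
have := @two_edge_color_cost am v w am0 _ w0 hm; lra.
Qed.

End Inequalities.

(** * Linear dependence *)

(** A matrix with rows [E] and columns [A] has more rows than columns, hence a nonzero vector in its
    left kernel; [h] extends it by 0 outside [E]. *)
Lemma kernel_vector (F : fieldType) (T I : finType) (E : {set T}) (A : {set I})
    (g : T -> I -> F) : (#|A| < #|E|)%N ->
  exists h : T -> F, [/\ exists2 e, e \in E & h e != 0,
    forall e, e \notin E -> h e = 0 &
    forall i, i \in A -> \sum_e h e * g e i = 0].
Proof.
move=> ltAE.
pose M := \matrix_(r < #|E|, c < #|A|) g (enum_val r) (enum_val c).
have /matrix0Pn[r0 [r1 v1]] : kermx M != 0.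
  rewrite -mxrank_eq0 mxrank_ker -lt0n subn_gt0.
  by apply: leq_ltn_trans ltAE; apply: rank_leq_col.
pose v r := kermx M r0 r.
pose h e := \sum_(r < #|E|) (enum_val r == e)%:R * v r.
exists h; split.
- exists (enum_val r1); first exact: enum_valP.
  rewrite /h (bigD1 r1) //= eqxx mul1r big1 ?addr0 // => r rr1.
  by rewrite (inj_eq enum_val_inj) (negbTE rr1) mul0r.
- move=> e eE; rewrite /h big1 // => r _.
  case: eqP => [re|_]; last by rewrite mul0r.
  by rewrite -re enum_valP in eE.
- move=> i iA.
  transitivity (\sum_r v r * g (enum_val r) i).
    rewrite /h; under eq_bigr do rewrite mulr_suml.
    rewrite exchange_big; apply: eq_bigr => r _ /=.
    rewrite (bigD1 (enum_val r)) //= eqxx mul1r big1 ?addr0 // => e ne.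
    by rewrite eq_sym (negbTE ne) !mul0r.
  have /matrixP/(_ r0 (enum_rank_in iA i)) := mulmx_ker M.
  rewrite mxE [RHS]mxE => hM; rewrite -[RHS]hM; apply: eq_bigr => r _.
  by rewrite [X in _ = _ * X]mxE enum_rankK_in.
Qed.

(** * Weights without x and the graph of the positive b_ij *)

Section Admissible.
Variables (R : rcfType) (n : nat).
Implicit Types (A : {set 'I_n}) (a : 'I_n -> R) (b : 'I_n -> 'I_n -> R).

Definition clustered_density A a b i :=
  a i ^+ 2 + 2 * a i * (\sum_(j in A) b i j) + \sum_(j in A) b i j ^+ 2.

Record admissible A a b : Prop := Admissible {
  adm_sym : forall i j, b i j = b j i;
  adm_diag : forall i, b i i = 0;
  adm_b_ge0 : forall i j, 0 <= b i j;
  adm_a_ge0 : forall i, 0 <= a i;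
  adm_density : forall i, i \in A -> 1 <= clustered_density A a b i }.

Definition cost A a b := \sum_(i in A) (2 * a i + \sum_(j in A) b i j).

(** Ordered pairs: each edge of the graph appears twice, so more than [2 * #|A|] pairs means more
    edges than colors. *)
Definition edges A b : {set 'I_n * 'I_n} :=
  [set e | [&& e.1 \in A, e.2 \in A & b e.1 e.2 != 0]].

Lemma edges_double A b : (forall i j, b i j = b j i) -> (forall i, b i i = 0) ->
  #|edges A b| = (2 * #|[set e in edges A b | (e.1 < e.2)%N]|)%N.
Proof.
move=> bC b0; pose L := [set e in edges A b | (e.1 < e.2)%N].
pose sw (e : 'I_n * 'I_n) := (e.2, e.1).
have swI : injective sw by move=> [i j] [i' j'] [-> ->].
rewrite -/L mul2n -addnn -[X in (_ + X)%N](card_imset (mem L) swI).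
have -> : edges A b = L :|: sw @: L.
  apply/setP=> -[i j]; rewrite !inE /=.
  have -> : ((i, j) \in sw @: L) = [&& i \in A, j \in A & b i j != 0] && (j < i)%N.
    have -> : (i, j) = sw (j, i) by [].
    by rewrite (mem_imset _ _ swI) !inE /= bC andbCA.
  rewrite -andb_orr; case: (ltngtP i j) => [||/val_inj ->] /=; rewrite ?andbT //.
  by rewrite b0 eqxx !andbF.
rewrite cardsU; have -> : L :&: sw @: L = set0; last by rewrite cards0 subn0.
apply/setP=> -[i j]; rewrite !inE /=.
have -> : (i, j) = sw (j, i) by [].
rewrite (mem_imset _ _ swI) !inE /=.
by case: (ltngtP i j); rewrite ?andbF.
Qed.

(* Along a direction orthogonal to all the gradients the densities are convex,
   hence do not decrease, and the direction is followed until an edge vanishes. *)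
Lemma reduce_edges A a b : admissible A a b -> (2 * #|A| < #|edges A b|)%N ->
  exists b', [/\ admissible A a b', cost A a b' <= cost A a b &
                 edges A b' \proper edges A b].
Proof.
move=> [bC b0 bge age bd] ltE.
pose E := [set e in edges A b | (e.1 < e.2)%N].
(* Half the partial derivative of the density of color i in the weight of the edge e. *)
pose g (e : 'I_n * 'I_n) i := (e.1 == i)%:R * (b i e.2 + a i) + (e.2 == i)%:R * (b i e.1 + a i).
have ltAE : (#|A| < #|E|)%N by move: ltE; rewrite edges_double // ltn_pmul2l.
have [h [[e0 e0E he0] hE hg]] := kernel_vector g ltAE.
have [H [HC Hd He HE Hsum]] : exists H : 'I_n -> 'I_n -> R, [/\ forall i j, H i j = H j i,
    forall i, i \in A -> \sum_(j in A) H i j * (b i j + a i) = 0,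
    exists e, H e.1 e.2 != 0,
    forall i j, H i j != 0 -> (i, j) \in edges A b &
    \sum_(i in A) \sum_(j in A) H i j <= 0].
  pose H i j := h (i, j) + h (j, i).
  have HC i j : H i j = H j i by rewrite /H addrC.
  have HE i j : H i j != 0 -> (i, j) \in edges A b.
    apply: contraR => nij; rewrite /H !hE ?addr0 //; last first.
      by rewrite inE (negbTE nij).
    by move: nij; rewrite !inE /= bC andbCA => /negbTE ->.
  have Hd i : i \in A -> \sum_(j in A) H i j * (b i j + a i) = 0.
    move=> iA; rewrite -[RHS](hg i iA).
    have -> : \sum_(j in A) H i j * (b i j + a i) = \sum_j H i j * (b i j + a i).
      rewrite [RHS](bigID (mem A)) /= [X in _ + X]big1 ?addr0 // => j jA.
      have [->|/HE] := eqVneq (H i j) 0; first by rewrite mul0r.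
      by rewrite inE /= (negbTE jA) andbF.
    have -> : \sum_e h e * g e i = \sum_p \sum_q h (p, q) * g (p, q) i.
      by rewrite pair_bigA; apply: eq_bigr => -[].
    rewrite /g /=.
    under [RHS]eq_bigr => p _.
      under eq_bigr => q _ do rewrite mulrDr.
      rewrite big_split /=; over.
    rewrite big_split /= [X in _ = X + _](bigD1 i) //= [X in _ = _ + X + _]big1 ?addr0; last first.
      move=> p /negbTE np; rewrite big1 // => q _.
      by rewrite np mul0r mulr0.
    rewrite [X in _ = _ + X]exchange_big /= [X in _ = _ + X](bigD1 i) //=.
    rewrite [X in _ = _ + (_ + X)]big1 ?addr0; last first.
      move=> p /negbTE np; rewrite big1 // => q _.
      by rewrite np mul0r mulr0.
    rewrite -big_split; apply: eq_bigr => j _ /=.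
    by rewrite eqxx !mul1r /H mulrDl.
  have e0H : H e0.1 e0.2 != 0.
    rewrite /H -surjective_pairing [X in _ + X]hE ?addr0 //.
    by move: e0E; rewrite inE => /andP[_ l]; rewrite inE /= negb_and -leqNgt (ltnW l) orbT.
  (* The sign is chosen so that moving along [H] does not raise the cost. *)
  have [le0|lt0] := lerP (\sum_(i in A) \sum_(j in A) H i j) 0.
    by exists H; split => //; exists e0.
  exists (fun i j => - H i j); split.
  - by move=> i j; rewrite HC.
  - move=> i iA; under eq_bigr do rewrite mulNr.
    by rewrite sumrN Hd // oppr0.
  - by exists e0; rewrite oppr_eq0.
  - by move=> i j; rewrite oppr_eq0; apply: HE.
  - by under eq_bigr do rewrite sumrN; rewrite sumrN oppr_le0 ltW.
have HA i j : H i j != 0 -> i \in A /\ j \in A.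
  by move/HE; rewrite inE /= => /and3P[].
have [e1 He1] : exists e, H e.1 e.2 < 0.
  have [/existsP[e]|/existsPn nex] := boolP [exists e : 'I_n * 'I_n, H e.1 e.2 < 0].
    by exists e.
  have Hge i j : 0 <= H i j by rewrite leNgt; apply: (nex (i, j)).
  case: He => -[i j] /= Hij; have [iA jA] := HA _ _ Hij.
  suff : 0 < \sum_(i in A) \sum_(j in A) H i j by rewrite ltNge Hsum.
  apply: (@lt_le_trans _ _ (H i j)); first by rewrite lt_neqAle eq_sym Hij Hge.
  rewrite (bigD1 i) //= (bigD1 j) //= -addrA lerDl addr_ge0 ?sumr_ge0 // => p _.
  exact: sumr_ge0.
have [e He2 emin] : exists2 e, H e.1 e.2 < 0 & forall e', H e'.1 e'.2 < 0 ->
    b e.1 e.2 / - H e.1 e.2 <= b e'.1 e'.2 / - H e'.1 e'.2.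
  case: (arg_minP (P := fun e => H e.1 e.2 < 0) (fun e => b e.1 e.2 / - H e.1 e.2) He1).
  move=> e P1 P2.
  by exists e.
(* The first time at which a decreasing edge weight reaches 0. *)
pose t := b e.1 e.2 / - H e.1 e.2.
have t0 : 0 <= t by rewrite /t divr_ge0 // oppr_ge0 ltW.
exists (fun i j => b i j + t * H i j).
have sub i j : (i, j) \notin edges A b -> H i j = 0.
  by apply: contraNeq; apply: HE.
split.
- split => //.
  + by move=> i j; rewrite bC HC.
  + by move=> i; rewrite b0 sub ?mulr0 ?addr0 // inE b0 eqxx !andbF.
  + move=> i j; have [Hlt|Hge] := ltP (H i j) 0; last by rewrite addr_ge0 // mulr_ge0.
    have := emin (i, j) Hlt; rewrite -/t /= ler_pdivlMr ?oppr_gt0 //; lra.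
  + move=> i iA; apply: le_trans (bd i iA) _; rewrite /clustered_density.
    have -> : \sum_(j in A) (b i j + t * H i j) ^+ 2 = \sum_(j in A) b i j ^+ 2
        + 2 * t * (\sum_(j in A) H i j * b i j) + t ^+ 2 * \sum_(j in A) H i j ^+ 2.
      rewrite !mulr_sumr -!big_split; apply: eq_bigr => j _ /=; ring.
    have := Hd i iA; under eq_bigr do rewrite mulrDr.
    rewrite !big_split /= -mulr_suml -mulr_sumr => hd.
    have : 0 <= t ^+ 2 * \sum_(j in A) H i j ^+ 2.
      by rewrite mulr_ge0 ?sqr_ge0 // sumr_ge0 // => j _; rewrite sqr_ge0.
    set SB := \sum_(j in A) b i j in hd *; set SH := \sum_(j in A) H i j in hd *.
    set SHb := \sum_(j in A) H i j * b i j in hd *.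
    have -> : SHb = - (SH * a i) by lra.
    lra.
- rewrite /cost.
  under eq_bigr do rewrite big_split -mulr_sumr addrA.
  rewrite big_split /= -mulr_sumr gerDl; exact: mulr_ge0_le0.
- apply/properP; split.
    apply/subsetP=> -[i j]; rewrite inE /= => /and3P[iA jA nz].
    rewrite inE /= iA jA /=; apply: contra nz => /eqP bz.
    by rewrite sub ?bz ?mulr0 ?addr0 // inE /= bz eqxx !andbF.
  exists e; first by rewrite [e]surjective_pairing HE // lt_eqF.
  have -> : e \in edges A (fun i j => b i j + t * H i j) = false; last by [].
  by rewrite inE /= /t invrN mulrN mulNr divfK ?(lt_eqF He2) // subrr eqxx !andbF.
Qed.


(** * Leaves and shortest edges *)

Definition neighbours A b i : {set 'I_n} := [set j in A | b i j != 0].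

Lemma sum_neighbours A b i p q (F : R -> R) : F 0 = 0 -> p != q ->
  neighbours A b i = [set p; q] -> \sum_(j in A) F (b i j) = F (b i p) + F (b i q).
Proof.
move=> F0 pq Npq.
have mem j : (j \in A) && (b i j != 0) = (j == p) || (j == q).
  by have /setP/(_ j) := Npq; rewrite !inE.
have [/andP[pA _] /andP[qA _]] : (p \in A) && (b i p != 0) /\ (q \in A) && (b i q != 0).
  by rewrite !mem !eqxx orbT.
rewrite (bigD1 p) //= (bigD1 q) /=; last by rewrite qA eq_sym.
rewrite big1 ?addr0 // => j /andP[/andP[jA jp] jq].
by have := mem j; rewrite (negbTE jp) (negbTE jq) jA => /negbT; rewrite negbK => /eqP ->.
Qed.

Lemma card_edges A b : #|edges A b| = (\sum_(i in A) #|neighbours A b i|)%N.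
Proof.
rewrite -sum1_card (eq_bigr (fun i => \sum_(j in A | b i j != 0%R) 1)%N); last first.
  by move=> i _; rewrite sum1dep_card.
by rewrite pair_big_dep; apply: eq_bigl => -[i j]; rewrite inE.
Qed.

Lemma adm_cost_ge1 A a b i : admissible A a b -> i \in A ->
  1 <= 2 * a i + \sum_(j in A) b i j.
Proof.
move=> adm iA.
have Bge S : 0 <= \sum_(j in S) b i j by apply: sumr_ge0 => j _; apply: adm_b_ge0 adm _ _.
apply: (@color_cost_ge1 _ _ _ (\sum_(j in A) b i j ^+ 2) 0) => //; first exact: adm_a_ge0 adm _.
- rewrite [leRHS]expr2 mulr_suml; apply: ler_sum => j jA.
  by rewrite expr2 ler_wpM2l ?(adm_b_ge0 adm) // (bigD1 j) //= lerDl sumr_ge0 // => l _; apply: adm_b_ge0 adm _ _.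
- lra.
- by rewrite addr0; apply: adm_density adm _ iA.
Qed.

(* A color [i] meeting only [j] pays for the edge [ij] by itself; the other
   edges at [j] are turned into loops of their second endpoint. *)
Lemma remove_leaf A a b i j : admissible A a b -> i \in A -> j \in A -> i != j ->
    (forall l, l \in A -> l != j -> b i l = 0) ->
  let A' := A :\ i :\ j in let a' l := a l + b j l in
  admissible A' a' b /\ 2 + cost A' a' b <= cost A a b.
Proof.
move=> [bC b0 bge age bd] iA jA ij leaf A' a'.
have jAi : j \in A :\ i by rewrite !inE eq_sym ij.
have sumE (F : 'I_n -> R) : \sum_(l in A) F l = F i + (F j + \sum_(l in A') F l).
  by rewrite (big_setD1 i) //= (big_setD1 j).
have A'P l : l \in A' -> [/\ l \in A, l != j & l != i].
  by rewrite !inE => /and3P[].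
have biA' l : l \in A' -> b i l = 0 by move=> /A'P[lA lj _]; apply: leaf.
split.
  split => // [l|l /[dup] lA' /A'P[lA lj li]]; first by rewrite addr_ge0.
  apply: le_trans (bd l lA) _; rewrite /clustered_density !sumE ![b l _]bC biA' // bC.
  (* Turning b_jl into a loop at l raises the density of l by twice this product. *)
  have : 0 <= b j l * \sum_(m in A') b l m by rewrite mulr_ge0 ?sumr_ge0.
  rewrite /a' [b j l]bC; lra.
(* The density of i is (a_i + b_ij)^2; the edge is counted at both ends, which yields the 2 in the
   cost bound. *)
have ci : 1 <= a i + b i j.
  have := bd i iA; rewrite /clustered_density !sumE b0.
  rewrite !(big1 _ (mem A')); try by move=> l /biA' ->; rewrite ?expr0n.
  have := age i; have := bge i j; nra.
rewrite /cost !sumE b0.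
rewrite [\sum_(l in A') b i l]big1 //.
under [X in _ <= _ + (_ + X)]eq_bigr => l lA'.
  rewrite sumE [b l i]bC biA' // [b l j]bC; over.
rewrite /= b0 [b j i]bC !addr0 !add0r.
under eq_bigr do rewrite mulrDr -addrA.
rewrite big_split [X in _ <= _ + (_ + X)]big_split /=.
under [X in _ <= _ + (_ + (_ + X))]eq_bigr do rewrite add0r.
rewrite !big_split /= -!mulr_sumr.
have := age j; lra.
Qed.

(* [pq] is a shortest edge of a 2-regular graph; [r = p] is allowed (triangle). *)
Lemma shrink_min_edge A a b p q p' q' r :
    admissible A a b -> p \in A -> q \in A -> q' \in A ->
    p != q -> q != p' -> p != q' -> q != r ->
    neighbours A b p = [set q; p'] -> neighbours A b q = [set p; q'] ->
    neighbours A b q' = [set q; r] ->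
    b p q <= b q q' -> b q q' <= b p p' ->
  #|A|%:R + 1 <= cost A a b \/
  exists a' b', [/\ admissible A a' b', cost A a' b' <= cost A a b &
                    edges A b' \proper edges A b].
Proof.
move=> adm pA qA q'A pq qp' pq' qr Np Nq Nq' tv vu.
have [bC b0 bge age bd] := adm.
have sum1 i x y : x != y -> neighbours A b i = [set x; y] ->
    \sum_(j in A) b i j = b i x + b i y.
  by move=> xy N; rewrite (sum_neighbours (F := id) _ xy N).
have dens i x y : i \in A -> x != y -> neighbours A b i = [set x; y] ->
    1 + 2 * b i x * b i y <= (a i + b i x + b i y) ^+ 2.
  move=> iA xy N; have := bd i iA; rewrite /clustered_density (sum1 _ _ _ xy N).
  by rewrite (sum_neighbours (F := fun z => z ^+ 2) _ xy N) ?expr0n //=; lra.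
have bpq : b p q != 0.
  by have : q \in neighbours A b p; [rewrite Np !inE eqxx | rewrite inE => /andP[]].
have bqq' : b q q' != 0.
  by have : q' \in neighbours A b q; [rewrite Nq !inE eqxx orbT | rewrite inE => /andP[]].
have p'A : p' \in A.
  by have : p' \in neighbours A b p; [rewrite Np !inE eqxx orbT | rewrite inE => /andP[]].
have qq' : q != q' by apply: contraNneq bqq' => <-; rewrite b0.
have sumE (F : 'I_n -> R) : \sum_(i in A) F i = F p + F q + \sum_(i in A :\ p :\ q) F i.
  by rewrite (big_setD1 p) //= (big_setD1 q) ?addrA // !inE eq_sym pq.
set t := b p q in tv *; set v := b q q' in tv vu *; set u := b p p' in vu *.
(* Loops max(0, 1 - u) at p and max(0, 1 - v) at q keep both densities at least 1 once pq is gone;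
   the test is whether this trade does not raise the cost. *)
have [le|lt] := leP (Num.max 0 (1 - u) + Num.max 0 (1 - v)) (t + a p + a q).
- right.
  pose a' i : R := if i == p then Num.max 0 (1 - u) else if i == q then Num.max 0 (1 - v) else a i.
  pose b' i j := if (i == p) && (j == q) || (i == q) && (j == p) then 0 else b i j.
  have qp : (q == p) = false by rewrite eq_sym (negbTE pq).
  have b'E i j : i != p -> i != q -> b' i j = b i j.
    by rewrite /b' => /negbTE -> /negbTE ->.
  have sump (F : R -> R) : F 0 = 0 -> \sum_(j in A) F (b' p j) = F u.
    move=> F0; rewrite (bigD1 p') //= big1 ?addr0.
      by rewrite /b' eqxx [p' == q]eq_sym (negbTE qp') (negbTE pq) ?andbF.
    move=> j /andP[jA jp']; rewrite /b' eqxx (negbTE pq) /= orbF.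
    case: eqVneq => // jq; have /setP/(_ j) := Np.
    by rewrite !inE jA (negbTE jq) (negbTE jp') => /negbT; rewrite negbK => /eqP ->.
  have sumq (F : R -> R) : F 0 = 0 -> \sum_(j in A) F (b' q j) = F v.
    move=> F0; rewrite (bigD1 q') //= big1 ?addr0.
      by rewrite /b' eqxx [q' == p]eq_sym (negbTE pq') qp.
    move=> j /andP[jA jq']; rewrite /b' eqxx qp /=.
    case: eqVneq => // jp; have /setP/(_ j) := Nq.
    by rewrite !inE jA (negbTE jp) (negbTE jq') => /negbT; rewrite negbK => /eqP ->.
  have maxP (z : R) : 0 <= z -> 1 <= Num.max 0 (1 - z) ^+ 2 + 2 * Num.max 0 (1 - z) * z + z ^+ 2.
    by move=> z0; case: (lerP (1 - z) 0) => z1; nra.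
  exists a', b'; split.
  + split.
    * by move=> i j; rewrite /b' bC orbC andbC [(j == q) && _]andbC.
    * by move=> i; rewrite /b' b0 if_same.
    * by move=> i j; rewrite /b'; case: ifP.
    * move=> i; rewrite /a'; case: eqP => _; first by rewrite le_max lexx.
      by case: eqP => _; first by rewrite le_max lexx.
    * move=> i iA; have [->|ip] := eqVneq i p.
        rewrite /clustered_density (sump id) // (sump (fun z => z ^+ 2)) ?expr0n //=.
        by rewrite /a' eqxx maxP // bge.
      have [->|iq] := eqVneq i q.
        rewrite /clustered_density (sumq id) // (sumq (fun z => z ^+ 2)) ?expr0n //=.
        by rewrite /a' eqxx qp maxP // bge.
      apply: le_trans (bd i iA) _; rewrite /clustered_density /a' (negbTE ip) (negbTE iq).
      by under eq_bigr do rewrite -b'E //; under [X in _ + X <= _]eq_bigr do rewrite -b'E //.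
  + rewrite /cost ![\sum_(i in A) (_ + _)]sumE (sump id) // (sumq id) //.
    rewrite (sum1 _ _ _ qp' Np) (sum1 _ _ _ pq' Nq) -/t -/u -/v [b q p]bC -/t /a' eqxx qp eqxx.
    have -> : \sum_(i in A :\ p :\ q) (2 * (if i == p then Num.max 0 (1 - u)
        else if i == q then Num.max 0 (1 - v) else a i) + \sum_(j in A) b' i j)
      = \sum_(i in A :\ p :\ q) (2 * a i + \sum_(j in A) b i j).
      apply: eq_bigr => i; rewrite !inE => /and3P[iq ip _].
      by rewrite (negbTE ip) (negbTE iq); congr (_ + _); apply: eq_bigr => j _; apply: b'E.
    lra.
  + apply/properP; split.
      apply/subsetP=> -[i j]; rewrite !inE /= => /and3P[-> -> ] /=; rewrite /b'.
      by case: ifP; rewrite ?eqxx.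
    by exists (p, q); rewrite !inE /= ?pA ?qA ?bpq // /b' !eqxx.
(* Now p, q and q' cost at least 4 together, and every other color at least 1. *)
left.
have gain : 4 <= (2 * a p + (t + u)) + (2 * a q + (t + v)) + (2 * a q' + (v + b q' r)).
  apply: cycle_gain lt => //; rewrite ?age ?bge //.
  - exact: dens.
  - by have := dens q p q' qA pq' Nq; rewrite [b q p]bC.
  - by have := dens q' q r q'A qr Nq'; rewrite [b q' q]bC.
rewrite /cost -sum1_card natr_sum sumE [\sum_(i in A) (_ + _)]sumE !(big_setD1 q' (A := A :\ p :\ q)) /=; try by rewrite !inE q'A [q' == p]eq_sym pq' eq_sym qq'.
rewrite (sum1 _ _ _ qp' Np) (sum1 _ _ _ pq' Nq) (sum1 _ _ _ qr Nq') [b q p]bC [b q' q]bC.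
rewrite -/t -/u -/v.
set S1 := \sum_(i in _) _; set S2 := \sum_(i in _) _.
have : S1 <= S2.
  by apply: ler_sum => i; rewrite !inE => /and4P[_ _ _ iA]; apply: adm_cost_ge1.
lra.
Qed.

(** * An odd number of colors without x *)

(** Induction on the number of colors and, inside it, on the number of edges. Removing a leaf with
    its neighbour takes away two colors, so parity is kept; the base is a single color, where a >=
    1. *)
Lemma odd_cost A a b : admissible A a b -> odd #|A| -> #|A|%:R + 1 <= cost A a b.
Proof.
have [m] := ubnP #|A|; elim: m A a b => // m IHm A a b ltAm.
have [N] := ubnP #|edges A b|; elim: N a b => // N IHN a b ltN adm oddA.
have shrink a' b' : admissible A a' b' -> cost A a' b' <= cost A a b ->
    edges A b' \proper edges A b -> #|A|%:R + 1 <= cost A a b.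
  move=> adm' le /proper_card lt; apply: le_trans le; apply: IHN => //.
  by apply: leq_trans lt _.
have [bC b0 bge age bd] := adm.
have [/cards1P[i Ai]|A1] := boolP (#|A| == 1)%N.
  have iA : i \in A by rewrite Ai set11.
  have := bd i iA; rewrite /cost /clustered_density Ai cards1 !big_set1 b0.
  have := age i; nra.
(* A color without neighbours also counts as a leaf, for any other color [j]. *)
have [/exists_inP[i iA /exists_inP[j jA /andP[ij /forall_inP leaf]]]|noleaf] := boolP
    [exists i in A, exists j in A, (i != j) && [forall l in A, (l != j) ==> (b i l == 0)]].
  have [|adm' le] := remove_leaf adm iA jA ij.
    by move=> l lA lj; have := leaf l lA; rewrite lj => /eqP.
  have cA : #|A| = (#|A :\ i :\ j|.+2)%N.
    by rewrite (cardsD1 i) iA (cardsD1 j (A :\ i)) !inE jA eq_sym ij.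
  apply: le_trans le; rewrite cA -natr1 -natr1.
  move: oddA ltAm; rewrite cA /= negbK => oddA' /ltnW ltA'm.
  have := IHm _ _ _ ltA'm adm' oddA'; lra.
have [ltE|leE] := ltnP (2 * #|A|) #|edges A b|.
  by have [b' [adm' le prop]] := reduce_edges adm ltE; exact: shrink adm' le prop.
have deg2 i : i \in A -> (2 <= #|neighbours A b i|)%N.
  move=> iA; rewrite leqNgt ltnS; apply/negP => /card_le1_eqP N1.
  case/negP: noleaf; apply/exists_inP; exists i => //.
  have nbrP j : (j \in neighbours A b i) = (j \in A) && (b i j != 0) by rewrite inE.
  have [N0|[j jN]] := set_0Vmem (neighbours A b i).
    have [j] : exists j, j \in A :\ i.
      apply/set0Pn; rewrite -card_gt0; have := cardsD1 i A; rewrite iA.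
      case: #|A :\ i| => // cA1; by rewrite cA1 in A1.
    rewrite !inE => /andP[ji jA]; apply/exists_inP; exists j => //.
    rewrite eq_sym ji; apply/forall_inP => l lA; apply/implyP => _.
    by have := nbrP l; rewrite N0 inE lA => /esym/negbT; rewrite negbK.
  have := jN; rewrite nbrP => /andP[jA bij]; apply/exists_inP; exists j => //.
  apply/andP; split; first by apply: contraNneq bij => ->; rewrite b0.
  apply/forall_inP => l lA; apply/implyP; apply: contraR => bil.
  by apply/eqP/N1 => //; rewrite nbrP lA.
have two i j : i \in A -> j \in neighbours A b i ->
    exists2 l, j != l & neighbours A b i = [set j; l].
  move=> iA jN.
  (* All degrees are at least 2 and their sum is at most [2 * #|A|], so each equals 2. *)
  have /eqP/cards2P[x [y [xy Nxy]]] : #|neighbours A b i| = 2%N.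
    apply/eqP; rewrite eqn_leq deg2 // andbT.
    have : (\sum_(l in A) #|neighbours A b l| <= \sum_(l in A) 2)%N.
      by rewrite -card_edges sum_nat_const mulnC.
    rewrite (bigD1 i) //= [X in (_ <= X)%N](bigD1 i) //=.
    have : (\sum_(l in A | l != i) 2 <= \sum_(l in A | l != i) #|neighbours A b l|)%N.
      by apply: leq_sum => l /andP[lA _]; apply: deg2.
    rewrite -(leq_add2l #|neighbours A b i|) => le1 /(leq_trans le1).
    by rewrite leq_add2r.
  move: jN; rewrite Nxy !inE => /orP[]/eqP ->; first by exists y.
  by exists x; [rewrite eq_sym | rewrite setUC].
have [e0 e0E] : exists e, e \in edges A b.
  have [i iA] : exists i, i \in A by apply/card_gt0P; case: #|A| oddA.
  have /card_gt0P[j] : (0 < #|neighbours A b i|)%N by apply: leq_trans (deg2 i iA).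
  by rewrite inE => /andP[jA bij]; exists (i, j); rewrite inE iA jA.
case: (arg_minP (P := fun e => e \in edges A b) (fun e => b e.1 e.2) e0E).
move=> -[p q]; rewrite inE => /and3P[/= pA qA bpq] pqmin.
have minE i j : j \in A -> i \in neighbours A b j -> b p q <= b j i.
  by move=> jA; rewrite inE => /andP[iA bji]; apply: (pqmin (j, i)); rewrite inE /= jA iA.
have qNp : q \in neighbours A b p by rewrite inE qA.
have pNq : p \in neighbours A b q by rewrite inE pA bC.
have [p' qp' Np] := two _ _ pA qNp; have [q' pq' Nq] := two _ _ qA pNq.
have p'N : p' \in neighbours A b p by rewrite Np !inE eqxx orbT.
have q'N : q' \in neighbours A b q by rewrite Nq !inE eqxx orbT.
have p'A : p' \in A by move: p'N; rewrite inE => /andP[].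
have q'A : q' \in A by move: q'N; rewrite inE => /andP[].
have pNp' : p \in neighbours A b p' by move: p'N; rewrite !inE pA bC => /andP[_ ->].
have qNq' : q \in neighbours A b q' by move: q'N; rewrite !inE qA bC => /andP[_ ->].
have pq : p != q by apply: contraNneq bpq => ->; rewrite b0.
(* Of the two edges next to the shortest edge, the shorter one has to play the role of v; the ends
   are swapped if necessary. *)
have [vu|/ltW uv] := leP (b q q') (b p p').
  have [r qr Nq'] := two _ _ q'A qNq'.
  have := shrink_min_edge adm pA qA q'A pq qp' pq' qr Np Nq Nq' (minE _ _ qA q'N) vu.
  by case=> // -[a' [b' [adm' le prop]]]; exact: shrink adm' le prop.
have [r pr Np'] := two _ _ p'A pNp'.
have := shrink_min_edge adm qA pA p'A _ pq' qp' pr Nq Np Np' _ uv.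
rewrite eq_sym bC => /(_ pq (minE _ _ pA p'N)).
by case=> // -[a' [b' [adm' le prop]]]; exact: shrink adm' le prop.
Qed.

End Admissible.

(** * The total weight in the presence of x *)

(** [W2] is twice the total weight W, so the alternatives read W >= ceil(k / 2) and W^2 >= 2 k -
    1. *)
Lemma total_weight_lower_bound (R : rcfType) (k : nat) (a : 'I_k -> R)
    (b : 'I_k -> 'I_k -> R) (x : R) :
    (forall i j, b i j = b j i) -> (forall i, b i i = 0) ->
    (forall i j, 0 <= b i j) -> (forall i, 0 <= a i) -> 0 <= x ->
    (forall i, 1 <= a i ^+ 2 + 2 * a i * (\sum_j b i j + x) + \sum_j b i j ^+ 2) ->
  let W2 := \sum_i (2 * a i + \sum_j b i j) + 2 * x in
  2 * (uphalf k)%:R <= W2 \/ 4 * (2 * k%:R - 1) <= W2 ^+ 2.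
Proof.
move=> bC b0 bge age x0 dens W2.
have Bge i : 0 <= \sum_j b i j by apply: sumr_ge0.
have QB i : \sum_j b i j ^+ 2 <= (\sum_j b i j) ^+ 2.
  rewrite [leRHS]expr2 mulr_suml; apply: ler_sum => j _.
  by rewrite expr2 ler_wpM2l // (bigD1 j) //= lerDl sumr_ge0.
have sum_const (c : R) : \sum_(i < k) c = k%:R * c.
  by rewrite sumr_const card_ord mulr_natl.
have [x34|x34] := leP x (3 / 4); last first.
  right; pose r := Num.sqrt (x ^+ 2 + 1) - x.
  have z2 : Num.sqrt (x ^+ 2 + 1) ^+ 2 = x ^+ 2 + 1.
    by rewrite sqr_sqrtr // addr_ge0 ?sqr_ge0.
  have z0 : 0 <= Num.sqrt (x ^+ 2 + 1) by apply: sqrtr_ge0.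
  have hr : r ^+ 2 + 2 * r * x = 1 by rewrite /r; lra.
  have r01 : 0 <= r <= 1 / 2 by apply/andP; split; rewrite /r; nra.
  have le : 2 * (k%:R * r + x) <= W2.
    rewrite mulrDr lerD2r mulrCA -sum_const; apply: ler_sum => i _.
    exact: (color_cost_large_x (age i) (Bge i) (QB i) x0 r01 hr (dens i)).
  have k0 : 0 <= k%:R :> R by [].
  have e : (k%:R * r + x) ^+ 2 - (2 * k%:R - 1) = ((k%:R - 1) * r - x) ^+ 2.
    transitivity (((k%:R - 1) * r - x) ^+ 2 + (2 * k%:R - 1) * (r ^+ 2 + 2 * r * x - 1)); first ring.
    by rewrite hr subrr mulr0 addr0.
  have : 0 <= ((k%:R - 1) * r - x) ^+ 2 by apply: sqr_ge0.
  have /andP[r0 _] := r01.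
  have : 0 <= k%:R * r + x by rewrite addr_ge0 ?mulr_ge0.
  move: e le; set z := k%:R * r + x => e le z1 sq.
  have : (2 * z) ^+ 2 <= W2 ^+ 2 by rewrite ler_sqr ?nnegrE //; lra.
  lra.
left.
have cost1 i : 1 <= 2 * a i + \sum_j b i j.
  exact: color_cost_ge1 (age i) (Bge i) (QB i) x34 (dens i).
have sum1 : k%:R <= \sum_i (2 * a i + \sum_j b i j).
  by rewrite -[k%:R]mulr1 -sum_const; apply: ler_sum.
have -> : 2 * (uphalf k)%:R = k%:R + (odd k)%:R :> R.
  rewrite -natrM -natrD -[k in RHS]odd_double_half uphalf_half.
  by congr (_%:R); case: (odd k); lia.
have [oddk|] := boolP (odd k); last by rewrite addr0 /W2; lra.
have [x12|x12] := leP x (1 / 2); last by rewrite /W2 /=; lra.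
have choose i : exists a', [/\ a i <= a', 1 <= a' ^+ 2 + 2 * a' * \sum_j b i j + \sum_j b i j ^+ 2 &
    (1 - 2 * x) * (a' - a i) <= x * (2 * a i + \sum_j b i j - 1)].
  have [a' le [h1 h2]] := raise_loop (age i) (Bge i) (QB i) x0 x12 (dens i).
  by exists a'.
have [a' a'P] := fin_all_exists choose.
(* In the first case raising the loops costs no more than discarding x saves, and [odd_cost]
   applies. *)
have [le|lt] := leP (\sum_i (a' i - a i)) x.
  have adm : admissible [set: 'I_k] a' b.
    split=> // [i|i _]; first by have [+ _ _] := a'P i; apply: le_trans.
    have [_ + _] := a'P i; rewrite /clustered_density.
    by rewrite !(eq_bigl _ _ (in_setT (T := 'I_k))).
  have := odd_cost adm; rewrite cardsT card_ord => /(_ oddk).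
  rewrite /cost (eq_bigl _ _ (in_setT (T := 'I_k))).
  under eq_bigr do rewrite (eq_bigl _ _ (in_setT (T := 'I_k))).
  move: le; rewrite /W2 !big_split /= -!mulr_sumr sumrN; lra.
(* The increments sum to more than x, so after division by x this bound makes the colors cost at
   least k + 1 - 2 x. *)
have le : (1 - 2 * x) * \sum_i (a' i - a i) <= x * (\sum_i (2 * a i + \sum_j b i j) - k%:R).
  rewrite -[k%:R]mulr1 -sum_const -sumrB !mulr_sumr.
  by apply: ler_sum => i _; have [] := a'P i.
have [xe0|xn0] := eqVneq x 0; first by move: lt le; rewrite xe0 mulr0 subr0 mul1r mul0r => /lt_geF ->.
have xp : 0 < x by rewrite lt_neqAle eq_sym xn0.
rewrite /W2 /=; set S := \sum_i (2 * _ + _) in le *.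
suff : 1 - 2 * x <= S - k%:R by lra.
rewrite -(ler_pM2l xp); apply: le_trans le.
by rewrite mulrC ler_wpM2l ?(ltW lt) //; lra.
Qed.

(** * Scaling back to densities *)

Lemma double_edge_sum (R : realType) (k : nat) (b : 'I_k -> 'I_k -> R) :
  (forall i j, b i j = b j i) ->
  \sum_(i < k) \sum_(j < k | j != i) b i j = 2 * \sum_(i < k) \sum_(j < k | (i < j)%N) b i j.
Proof.
move=> bC; rewrite mulr_natl mulr2n.
rewrite [X in _ = _ + X](exchange_big_dep predT) //= -big_split.
apply: eq_bigr => i _; rewrite (bigID (fun j : 'I_k => (i < j)%N)) /=; congr (_ + _).
  by apply: eq_bigl => j; rewrite -val_eqE /=; case: ltngtP.
under [RHS]eq_bigr do rewrite bC.
by apply: eq_bigl => j; rewrite -val_eqE /=; case: ltngtP.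
Qed.

Lemma min_ord_le (R : realType) (k : nat) (hk : (0 < k)%N) (d : 'I_k -> R) i :
  min_ord hk d <= d i.
Proof. by rewrite /min_ord (bigD1 i) //= ge_min lexx. Qed.

(** f(k) is the larger of the two values: for k >= 1, ceil(k / 2)^2 <= 2 k - 1 holds exactly when k
    <= 6. *)
Lemma density_bound_ge (R : realType) (k : nat) : (0 < k)%N ->
  (2 * k%:R - 1)^-1 <= density_bound R k /\ (uphalf k)%:R ^- 2 <= density_bound R k.
Proof.
move=> k0; have k1 : 1 <= k%:R :> R by rewrite ler1n.
have u1 : 1 <= (uphalf k)%:R :> R by rewrite ler1n; lia.
rewrite /density_bound; case: leqP => k6; split=> //; rewrite lef_pV2 ?posrE; try nra.
- have : ((uphalf k) ^ 2 <= 2 * k - 1)%N.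
    by case: k {k1 u1} k0 k6 => // -[|[|[|[|[|[|]]]]]].
  rewrite -(ler_nat R) natrX natrB; last by lia.
  by rewrite natrM.
- have : (2 * k - 1 <= (uphalf k) ^ 2)%N by rewrite uphalf_half; nia.
  rewrite -(ler_nat R) natrX natrB; last by lia.
  by rewrite natrM.
Qed.

Theorem theorem2 (R : realType) (k : nat) (hk : (1 <= k)%N)
  (x : R) (a : 'I_k -> R) (b : 'I_k -> 'I_k -> R)
  (hx : 0 <= x)
  (ha : forall i : 'I_k, 0 <= a i)
  (hbsym : forall i j : 'I_k, b i j = b j i)
  (hb : forall i j : 'I_k, (i < j)%N -> 0 <= b i j)
  (hsum : \sum_(i < k) \sum_(j < k | (i < j)%N) b i j
          + \sum_(i < k) a i + x = 1) :
  min_ord hk (color_density b a x) <= density_bound R k.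
Proof.
have [leu lek] : (2 * k%:R - 1)^-1 <= density_bound R k /\
    (uphalf k)%:R ^- 2 <= density_bound R k by apply: density_bound_ge.
have k1 : 1 <= k%:R :> R by rewrite ler1n.
have u1 : 1 <= (uphalf k)%:R :> R by rewrite ler1n; lia.
set m := min_ord hk _.
have [m0|m0] := leP m 0.
  by apply: le_trans m0 (le_trans _ leu); rewrite invr_ge0; lra.
pose s := Num.sqrt m.
have s0 : 0 < s by rewrite sqrtr_gt0.
have s2 : s ^+ 2 = m by rewrite sqr_sqrtr // ltW.
(* Multiplying all weights by [c] makes every density at least 1 and the total weight equal to
   [c]. *)
pose c := s^-1.
have c0 : 0 <= c by rewrite invr_ge0 ltW.
(* The diagonal is set to 0 so that sums over all j agree with sums over j != i. *)
pose b' i j := if i == j then 0 else c * b i j.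
have sumb' (F : R -> R) i : F 0 = 0 -> \sum_j F (b' i j) = \sum_(j < k | j != i) F (c * b i j).
  move=> F0; rewrite (bigD1 i) //= /b' eqxx F0 add0r.
  by apply: eq_bigr => j; rewrite eq_sym => /negbTE ->.
have cm : c ^+ 2 * m = 1 by rewrite -s2 -exprMn mulVf ?expr1n ?gt_eqF.
have W2E : \sum_i (2 * (c * a i) + \sum_j b' i j) + 2 * (c * x) = 2 * c.
  under eq_bigr do rewrite (sumb' id) //= -mulr_sumr.
  rewrite big_split /= -!mulr_sumr (double_edge_sum hbsym).
  rewrite -[2 * c]mulr1 -hsum; ring.
have : 2 * (uphalf k)%:R <= 2 * c \/ 4 * (2 * k%:R - 1) <= (2 * c) ^+ 2.
  rewrite -W2E; apply: total_weight_lower_bound.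
  - by move=> i j; rewrite /b' eq_sym hbsym.
  - by move=> i; rewrite /b' eqxx.
  - move=> i j; rewrite /b'; case: eqVneq => // ij; rewrite mulr_ge0 //.
    by have [/hb//|/hb|/val_inj e] := ltngtP i j; [rewrite hbsym | rewrite e eqxx in ij].
  - by move=> i; rewrite mulr_ge0.
  - by rewrite mulr_ge0.
  - move=> i; rewrite (sumb' id) // (sumb' (fun z => z ^+ 2)) ?expr0n //= -mulr_sumr.
    under [X in _ + X]eq_bigr do rewrite exprMn.
    rewrite -mulr_sumr -[leLHS]cm.
    have := ler_wpM2l (sqr_ge0 c) (min_ord_le hk (color_density b a x) i).
    rewrite -/m /color_density -mulr_sumr; lra.
case=> [|kc].
  rewrite ler_pM2l // => uc; apply: le_trans lek.
  rewrite -[m]invrK lef_pV2 ?posrE ?invr_gt0 //; last by nra.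
  have -> : m^-1 = c ^+ 2 by rewrite /c exprVn s2.
  by rewrite ler_sqr ?nnegrE //; lra.
apply: le_trans leu.
rewrite -[m]invrK lef_pV2 ?posrE ?invr_gt0 //; last by lra.
have -> : m^-1 = c ^+ 2 by rewrite /c exprVn s2.
lra.
Qed.
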